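(* Let $f$ and $g$ be p.m.p. actions of the finitely generated group $\Gamma$ on $(X,\mathcal{B},\mu)$ and $(Y,\mathcal{C},\nu)$, respectively, such that $f$ weakly contains $g$. Then $\mathrm{gcost}(f)\le\mathrm{gcost}(g)$.
   Context: A p.m.p. (probability measure preserving) action $f$ of a countable group $\Gamma$ on a standard Borel probability space $(X,\mathcal{B},\mu)$ assigns to each $\gamma\in\Gamma$ a measure preserving Borel transformation $f_\gamma$ of $X$, with $f_{\gamma\delta}=f_\gamma f_\delta$. Actions are not assumed to be free. Weak containment: $f$ weakly contains $g$ if for all Borel subsets $Y_1,\ldots,Y_n\in\mathcal{C}$, every finite set $S\subseteq\Gamma$ and every $\varepsilon>0$ there exist Borel subsets $X_1,\ldots,X_n\in\mathcal{B}$ such that $$\left|\mu(f_\gamma X_i\cap X_j)-\nu(g_\gamma Y_i\cap Y_j)\right|<\varepsilon\quad(1\le i,j\le n,\ \gamma\in S).$$ Groupoid cost: endow $\Gamma$ with the discrete topology and counting measure, and $X\times\Gamma$ with the product Borel structure and the product measure $\widetilde{\mu}$. The product of $(x_1,\gamma_1)$ and $(x_2,\gamma_2)$ in $X\times\Gamma$ is defined only when $f_{\gamma_1}x_1=x_2$, and then $(x_1,\gamma_1)\cdot(x_2,\gamma_2)=(x_1,\gamma_2\gamma_1)$. The inverse is $(x,\gamma)^{-1}=(f_\gamma x,\gamma^{-1})$. For Borel subsets $A,B\subseteq X\times\Gamma$ let $A\cdot B=\{a\cdot b\mid a\in A,\ b\in B,\ a\cdot b\text{ is defined}\}$, let $A^{-1}=\{a^{-1}\mid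 a\in A\}$, and let $E=X\times\{e\}$ with $e$ the identity of $\Gamma$. A Borel set $A\subseteq X\times\Gamma$ generates $f$ if $$\bigcup_{n=1}^{\infty}\left(A\cup A^{-1}\cup E\right)^n=X\times\Gamma.$$ The groupoid cost is $\mathrm{gcost}(f)=\inf\{\widetilde{\mu}(A)\mid A\text{ generates }f\}$. *)

(* Defs.v *)
From HB Require Import structures.
From mathcomp Require Import all_boot all_order all_algebra.
From mathcomp Require Import all_classical all_reals all_analysis.

Set Implicit Arguments.
Unset Strict Implicit.
Unset Printing Implicit Defensive.

Import Order.TTheory GRing.Theory Num.Theory.

Local Open Scope classical_set_scope.
Local Open Scope ring_scope.

Definition finitely_generated (G : groupType) : Prop :=
  exists2 S : set G, finite_set S &
    forall H : set G, S `<=` H -> H 1%g ->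
      (forall x y, H x -> H y -> H (x * y)%g) ->
      (forall x, H x -> H x^-1%g) -> H = setT.

(* A pseudometric space is metric exactly when it is Hausdorff. *)
Definition polish_space (R : realType) (T : completePseudoMetricType R) : Prop :=
  hausdorff_space T /\ exists2 D : set T, countable D & dense D.

Definition standard_borel (R : realType) d (X : measurableType d) : Prop :=
  exists (T : completePseudoMetricType R) (phi : X -> T),
    [/\ polish_space T, bijective phi &
        forall B : set T, measurable (phi @^-1` B) <-> <<s open >> B].

(* The carrier of G with the sigma-algebra of all subsets, i.e. the Borel sets
   of the discrete topology. *)
Definition discrete_group (G : groupType) : Type := G.

Section discrete_group_measurable.
Variable G : groupType.
HB.instance Definition _ := Group.on (discrete_group G).
HB.instance Definition _ := isPointed.Build (discrete_group G) 1%g.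
HB.instance Definition _ := @isMeasurable.Build default_measure_display
  (discrete_group G) discrete_measurable
  (@discrete_measurable0 _) (@discrete_measurableC _) (@discrete_measurableU _).
End discrete_group_measurable.

Record pmp_action (R : realType) (G : groupType) d (X : measurableType d)
    (mu : probability X R) := PmpAction {
  act :> G -> X -> X ;
  act1 : act 1%g = id ;
  actM : forall a b, act (a * b)%g = act a \o act b ;
  act_measurable : forall a, measurable_fun setT (act a) ;
  act_preserving : forall a (A : set X),
    measurable A -> mu (act a @^-1` A) = mu A }.

Section action_theory.
Context (R : realType) (G : groupType).

Definition weakly_contains dX (X : measurableType dX) (mu : probability X R)
    dY (Y : measurableType dY) (nu : probability Y R)
    (f : pmp_action G mu) (g : pmp_action G nu) : Prop :=
  forall (n : nat) (B : 'I_n -> set Y), (forall i, measurable (B i)) ->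
  forall S : set G, finite_set S ->
  forall e : R, 0 < e ->
  exists2 A : 'I_n -> set X, (forall i, measurable (A i)) &
    forall i j a, S a ->
      (`| mu ((f a @` A i) `&` A j) - nu ((g a @` B i) `&` B j) | < e%:E)%E.

Context d (X : measurableType d) (mu : probability X R) (f : pmp_action G mu).
Local Notation groupoid := (X * discrete_group G)%type.

Definition groupoid_unit : set groupoid := [set p | p.2 = 1%g].

Definition groupoid_inv (A : set groupoid) : set groupoid :=
  [set (f p.2 p.1, p.2^-1%g) | p in A].

(* The product p * q is defined only when f p.2 p.1 = q.1. *)
Definition groupoid_mul (A B : set groupoid) : set groupoid :=
  [set r | exists p q : groupoid,
    [/\ A p, B q, f p.2 p.1 = q.1 & r = (p.1, (q.2 * p.2)%g)]].

(* The n-th term of the union is the power of exponent n + 1. *)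
Definition generates (A : set groupoid) : Prop :=
  let B := A `|` groupoid_inv A `|` groupoid_unit in
  \bigcup_n iter n (groupoid_mul B) B = [set: groupoid].

Definition gcost : \bar R :=
  ereal_inf [set (mu \x counting)%E A | A in
    [set A : set groupoid | measurable A /\ generates A]].

End action_theory.

(* Main.v *)
Require Import Defs.
From HB Require Import structures.
From mathcomp Require Import all_boot all_order all_algebra.
From mathcomp Require Import all_classical all_reals all_analysis.
From mathcomp Require Import measurable_realfun ring lra.

(* Let A generate g, and let S be a finite generating set of the group.
   Every point y has a finite list c of edges of A near y (a certificate)
   from which all edges (y, s), s in S, are obtained by products and
   inverses; whether a list of labels has this effect depends only on the
   group. There are countably many certificates c_0, c_1, ..., so the sets
   P_n of points certified by c_n with n < N cover all but a set of small
   measure, and these certificates involve a finite set F of labels. Weak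
   containment, applied to the slices of A with label in F and to the
   disjoint cells P_n minus P_0, ..., P_(n-1), gives slices on X of almost
   the same measures whose certified points again fill X up to a small set.
   Adding all edges labelled by S at the remaining points produces a
   generating set for f whose cost is at most that of A plus an arbitrarily
   small error. *)

Set Implicit Arguments.
Unset Strict Implicit.
Unset Printing Implicit Defensive.

Import Order.TTheory GRing.Theory Num.Theory.

Local Open Scope classical_set_scope.
Local Open Scope ring_scope.

(** * The subgroupoid generated by a set of edges *)

Section groupoid.
Context (R : realType) (G : groupType) d (X : measurableType d).
Context (mu : probability X R) (f : pmp_action G mu).
Local Notation groupoid := (X * discrete_group G)%type.

Definition symm (A : set groupoid) : set groupoid :=
  A `|` groupoid_inv f A `|` @groupoid_unit G d X.

(** The union equated with the whole groupoid in [generates], named so that membership of a single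
    edge can be tracked. *)
Definition generated (A : set groupoid) : set groupoid :=
  \bigcup_n iter n (groupoid_mul f (symm A)) (symm A).

Lemma actMx a b x : f (a * b)%g x = f a (f b x).
Proof. by rewrite actM. Qed.

Lemma act1x x : f 1%g x = x.
Proof. by rewrite act1. Qed.

Lemma actKx a : cancel (f a) (f a^-1%g).
Proof. by move=> x; rewrite -actMx mulVg act1x. Qed.

Lemma actVKx a : cancel (f a^-1%g) (f a).
Proof. by move=> x; rewrite -actMx mulgV act1x. Qed.

Lemma act_image a (A : set X) : f a @` A = f a^-1%g @^-1` A.
Proof.
apply/seteqP; split=> [_ [x Ax <-]|x Ax] /=; first by rewrite actKx.
by exists (f a^-1%g x) => //; rewrite actVKx.
Qed.

Lemma measurable_act_preimage a (A : set X) : measurable A -> measurable (f a @^-1` A).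
Proof. by move=> mA; rewrite -[X in measurable X]setTI; exact: act_measurable. Qed.

Lemma symm_sub (A : set groupoid) p : A p -> symm A p.
Proof. by left; left. Qed.

Lemma symm_inv (A : set groupoid) x a : A (f a x, a^-1%g) -> symm A (x, a).
Proof.
move=> Aa; left; right; exists (f a x, a^-1%g) => //=.
by rewrite actKx invgK.
Qed.

Lemma symm_unit (A : set groupoid) x : symm A (x, 1%g).
Proof. by right. Qed.

Lemma symmP (A : set groupoid) x a :
  symm A (x, a) -> [\/ A (x, a), A (f a x, a^-1%g) | a = 1%g].
Proof.
case=> [[|[[y b] Ab [<- <-]]]|]; [exact: Or31| |exact: Or33].
by apply: Or32; rewrite invgK actKx.
Qed.

Lemma generated_symm (A : set groupoid) p : symm A p -> generated A p.
Proof. by exists 0%N. Qed.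

Lemma generated1 (A : set groupoid) x : generated A (x, 1%g).
Proof. exact/generated_symm/symm_unit. Qed.

Lemma generated_mulS (A : set groupoid) x a b :
  symm A (x, a) -> generated A (f a x, b) -> generated A (x, (b * a)%g).
Proof. by move=> Aa [n _ Ab]; exists n.+1 => //; exists (x, a), (f a x, b). Qed.

(** The iterates multiply by [symm A] on the left, and a product traverses its left factor first. So
    the step prepends one edge at the start [x] of a path. *)
Lemma generated_ind (A : set groupoid) (P : X -> G -> Prop) :
  (forall x a, symm A (x, a) -> P x a) ->
  (forall x a b, symm A (x, a) -> generated A (f a x, b) -> P (f a x) b ->
     P x (b * a)%g) ->
  forall x a, generated A (x, a) -> P x a.
Proof.
move=> P0 PS x a [n _]; elim: n x a => [|n IH] x a /=; first exact: P0.
move=> [[y b] [[z c]]] /= [Ayb Azc yz [-> ->]]; rewrite -{}yz in Azc.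
by apply: PS => //; [exists n|exact: IH].
Qed.

Lemma generated_mul (A : set groupoid) x a b :
  generated A (x, a) -> generated A (f a x, b) -> generated A (x, (b * a)%g).
Proof.
move=> Aa; move: x a Aa b; apply: generated_ind => [|x a c Aa Ac IH b Ab].
  by move=> x a Aa b; exact: generated_mulS.
by rewrite mulgA; apply: generated_mulS => //; apply: IH; rewrite -actMx.
Qed.

Lemma generated_inv (A : set groupoid) x a :
  generated A (x, a) -> generated A (f a x, a^-1%g).
Proof.
have symmV y b : symm A (y, b) -> symm A (f b y, b^-1%g).
  case/symmP => [Ab|Ab|->]; last by rewrite invg1; exact: symm_unit.
  - by apply: symm_inv; rewrite actKx invgK.
  - exact: symm_sub.
move: x a; apply: generated_ind => [x a Aa|x a b Aa Ab IH].
  exact/generated_symm/symmV.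
rewrite actMx invgM; apply: generated_mul => //.
by rewrite actKx; exact/generated_symm/symmV.
Qed.

Lemma generates_generators (A : set groupoid) (S : set G) :
  (forall H : set G, S `<=` H -> H 1%g ->
      (forall x y, H x -> H y -> H (x * y)%g) ->
      (forall x, H x -> H x^-1%g) -> H = setT) ->
  (forall x s, S s -> generated A (x, s)) -> generates f A.
Proof.
(* Demanding the label at every base point makes [K] a subgroup: products and inverses change the
   base point. *)
move=> Sgen AS; pose K := [set a | forall x, generated A (x, a)].
have KT : K = setT.
  apply: Sgen => [s Ss x|x|a b Ka Kb x|a Ka x].
  - exact: AS.
  - exact: generated1.
  - exact: generated_mul.
  - by have := generated_inv (Ka (f a^-1%g x)); rewrite actVKx.
suff : generated A = setT by [].
apply/seteqP; split=> // -[x a] _.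
by have : K a by rewrite KT.
Qed.

(* An entry [(w, a)] of [c] stands for the edge labelled [a] at the point [f w x].
   Quantifying over [A] makes this a condition on the labels that can be checked
   in one action and used in another. *)
Definition certificate (S : set G) (c : seq (G * G)) : Prop :=
  forall (A : set groupoid) x,
    (forall p, p \in c -> A (f p.1 x, p.2)) ->
    forall s, S s -> generated A (x, s).

End groupoid.

(** * Finite certificates and their countability *)

Section certificates.
Context (R : realType) (G : groupType).
Context dX (X : measurableType dX) (mu : probability X R) (f : pmp_action G mu).
Context dY (Y : measurableType dY) (nu : probability Y R) (g : pmp_action G nu).

(** An edge of [symm g A] rests on at most one edge of [A]: itself, its inverse based at [g a y], or
    nothing for a unit. The same recipe works verbatim for [f]. *)
Lemma symm_certificate (A : set (Y * discrete_group G)) y a : symm g A (y, a) ->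
  exists2 c : seq (G * G), (forall p, p \in c -> A (g p.1 y, p.2)) &
    forall B x, (forall p, p \in c -> B (f p.1 x, p.2)) -> symm f B (x, a).
Proof.
case/symmP => [Aa|Aa|->].
- exists [:: (1%g, a)] => [p|B x]; first by rewrite inE => /eqP -> /=; rewrite act1x.
  by move=> /(_ _ (mem_head _ _)) /=; rewrite act1x; exact: symm_sub.
- exists [:: (a, a^-1%g)] => [p|B x]; first by rewrite inE => /eqP ->.
  by move=> /(_ _ (mem_head _ _)) /=; exact: symm_inv.
- by exists [::] => // B x _; exact: symm_unit.
Qed.

Lemma generated_certificate A y a : generated g A (y, a) ->
  exists2 c : seq (G * G), (forall p, p \in c -> A (g p.1 y, p.2)) &
    certificate f [set a] c.
Proof.
move: y a; apply: generated_ind => [y a|y a b].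
  move=> /symm_certificate[c Ac cP]; exists c => // B x Bc s ->.
  exact/generated_symm/cP.
move=> /symm_certificate[c Ac cP] _ [c' Ac' c'P].
(* The certificate [c'] is relative to the point [g a y]; multiplying its positions by [a] on the
   right makes it relative to [y]. *)
exists (c ++ [seq ((p.1 * a)%g, p.2) | p <- c']) => [p|B x Bc _ ->].
  rewrite mem_cat => /orP[/Ac //|/mapP[q /Ac' Aq ->]] /=.
  by rewrite actMx.
apply: generated_mulS; first by apply: cP => p pc; apply: Bc; rewrite mem_cat pc.
apply: c'P => // p pc'; rewrite -actMx.
apply: (Bc ((p.1 * a)%g, p.2)); rewrite mem_cat; apply/orP; right.
by apply/mapP; exists p.
Qed.

Lemma generates_certificate A (s : seq G) y : generates g A ->
  exists2 c : seq (G * G), (forall p, p \in c -> A (g p.1 y, p.2)) &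
    certificate f [set` s] c.
Proof.
move=> gA; elim: s => [|a s [c Ac cP]]; first by exists [::].
have : generated g A (y, a) by rewrite /generated [X in X _]gA.
move=> /generated_certificate[c' Ac' c'P].
exists (c ++ c') => [p|B x Bc b /=]; first by rewrite mem_cat => /orP[/Ac|/Ac'].
rewrite inE => /orP[/eqP ->|bs].
  by apply: c'P => // p pc; apply: Bc; rewrite mem_cat pc orbT.
by apply: cP => // p pc; apply: Bc; rewrite mem_cat pc.
Qed.
End certificates.

(** Words in the generators and their inverses, coded as lists of signs and indices, form a
    countable type, and their values form a subgroup containing the generators. This is what makes
    certificates countable. *)
Lemma finitely_generated_enum (G : groupType) : finitely_generated G ->
  exists e : nat -> G, forall a, exists n, e n = a.
Proof.
move=> [_ /finite_seqP[s ->] sgen].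
pose h (bn : bool * nat) : G := let a := nth 1%g s bn.2 in if bn.1 then a else a^-1%g.
pose ev (w : seq (bool * nat)) : G := foldr (fun bn a => (h bn * a)%g) 1%g w.
have evM v w : (ev (v ++ w) = ev v * ev w)%g.
  by elim: v => [|b v IH] /=; rewrite ?mul1g// IH mulgA.
have evV w : exists v, (ev v = (ev w)^-1)%g.
  elim: w => [|[b n] w [v IH]]; first by exists [::]; rewrite /= invg1.
  exists (v ++ [:: (~~ b, n)]); rewrite evM IH /= invgM mulg1; congr (_ * _)%g.
  by case: b; rewrite /h /= ?invgK.
have evT : range ev = setT.
  apply: sgen => [a /= sa||_ _ [v _ <-] [w _ <-]|_ [w _ <-]].
  - by exists [:: (true, index a s)] => //=; rewrite mulg1 /h /= nth_index.
  - by exists [::].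
  - by exists (v ++ w).
  - by have [v vw] := evV w; exists v.
exists (fun n => ev (odflt [::] (unpickle n))) => a.
have [w _ <-] : range ev a by rewrite evT.
by exists (pickle w); rewrite pickleK.
Qed.

(** * Cost as a sum of measures of slices *)

Section counting_lemmas.
Context (R : realType) (T : choiceType).

Lemma counting_seq (s : seq T) : uniq s -> counting [set` s] = ((size s)%:R : R)%:E.
Proof.
move=> us; rewrite /counting asboolT//; congr (_%:R%:E).
apply: perm_size; apply: uniq_perm => //.
move=> x; rewrite in_fset_set//.
by apply/idP/idP; rewrite inE.
Qed.

Lemma le_counting (A B : set T) : A `<=` B -> (counting A <= counting B :> \bar R)%E.
Proof.
move=> AB; rewrite /counting; case: asboolP => [fA|nfA]; case: asboolP => [fB|nfB].
- by rewrite lee_fin ler_nat; apply: finmap.fsubset_leq_card; rewrite -fset_set_sub.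
- by rewrite leey.
- by have := sub_finite_set AB fB.
- by [].
Qed.

Lemma counting_indic (U : Type) (s : seq T) (W : T -> set U) x : uniq s ->
  counting [set a | a \in s /\ W a x] = (\sum_(a <- s) (\1_(W a) x)%:E)%E :> \bar R.
Proof.
move=> us; have -> : [set a | a \in s /\ W a x] = [set` [seq a <- s | x \in W a]].
  apply/seteqP; split=> a /=; rewrite mem_filter.
    by move=> [-> Wax]; rewrite andbT; exact: mem_set.
  by move=> /andP[/set_mem].
rewrite counting_seq ?filter_uniq// size_filter sumEFin; congr _%:E.
rewrite -sum1_count natr_sum big_mkcond/=.
by apply: eq_bigr => a _; rewrite indicE; case: ifP.
Qed.

End counting_lemmas.

Section product_counting.
Context (R : realType) (G : groupType) d (X : measurableType d).
Context (mu : probability X R).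
Local Notation groupoid := (X * discrete_group G)%type.

(* Unlike [ge0_le_integral], without measurability of the functions. *)
Lemma le_integralT (u v : X -> \bar R) : (forall x, (0 <= u x)%E) ->
  (forall x, (u x <= v x)%E) -> (\int[mu]_x u x <= \int[mu]_x v x)%E.
Proof.
move=> u0 uv; have v0 x : (0 <= v x)%E by rewrite (le_trans (u0 x)).
rewrite !ge0_integralTE//; apply: ereal_sup_le => _ [h hu <-].
by exists h => // x; rewrite (le_trans (hu x)).
Qed.

Lemma integral_sum_indic (s : seq G) (W : G -> set X) :
  (forall a, measurable (W a)) ->
  (\int[mu]_x \sum_(a <- s) (\1_(W a) x)%:E = \sum_(a <- s) mu (W a))%E.
Proof.
move=> mW; rewrite ge0_integral_sum//.
- by apply: eq_bigr => a _; rewrite integral_indic// setIT.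
- by move=> a; apply/measurable_EFinP; exact: measurable_indic.
Qed.

Lemma product_counting_seq (s : seq G) (W : G -> set X) : uniq s ->
  (forall a, measurable (W a)) ->
  (mu \x counting)%E [set p : groupoid | p.2 \in s /\ W p.2 p.1] =
  (\sum_(a <- s) mu (W a))%E.
Proof.
move=> us mW; rewrite -integral_sum_indic// /product_measure1.
apply: eq_integral => x _ /=; rewrite -counting_indic// xsectionE.
by congr counting.
Qed.

(** Over each [x], the labels from [s] form a subset of the section of [A]. Dropping all other
    labels can only lower the cost. *)
Lemma product_counting_ge (s : seq G) (A : set groupoid) : uniq s ->
  measurable A ->
  (\sum_(a <- s) mu (ysection A a) <= (mu \x counting) A)%E.
Proof.
move=> us mA; rewrite -(integral_sum_indic s); last first.
  by move=> a; exact: measurable_ysection.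
apply: le_integralT => x; first by rewrite sume_ge0// => a _; rewrite lee_fin.
rewrite -counting_indic//; apply: le_counting => a [_].
by rewrite ysectionE xsectionE.
Qed.

Lemma measurable_groupoid_seq (s : seq G) (W : G -> set X) :
  (forall a, measurable (W a)) ->
  measurable [set p : groupoid | p.2 \in s /\ W p.2 p.1].
Proof.
move=> mW.
have -> : [set p : groupoid | p.2 \in s /\ W p.2 p.1] =
    \bigcup_(a in [set` s]) (W a `*` [set a : discrete_group G]).
  apply/seteqP; split=> [[x a] [sa Wa]|[x a] [b sb [Wb /= ->]]] //.
  by exists a.
by apply: fin_bigcup_measurable => // a _; exact: measurableX.
Qed.
End product_counting.

(** * Union bounds and exhaustion for probabilities *)

Section probability_lemmas.
Context (R : realType) d (X : measurableType d) (mu : probability X R).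
Local Notation Pr A := (fine (mu A)).
Implicit Types A B D : set X.

Lemma fine_probability A : measurable A -> (Pr A)%:E = mu A.
Proof. by move=> mA; rewrite fineK// fin_num_measure. Qed.

Lemma fine_probability_ge0 A : 0 <= Pr A.
Proof. by rewrite fine_ge0. Qed.

Lemma le_fine_probability A B : measurable A -> measurable B -> A `<=` B -> Pr A <= Pr B.
Proof.
by move=> mA mB AB; rewrite -lee_fin !fine_probability// le_measure ?inE.
Qed.

Lemma fine_probabilityDI A B : measurable A -> measurable B ->
  Pr A = Pr (A `\` B) + Pr (A `&` B).
Proof.
move=> mA mB; apply/EFin_inj; rewrite EFinD !fine_probability//.
- exact: measureDI.
- exact: measurableI.
- exact: measurableD.
Qed.

Lemma fine_probabilityU A B : measurable A -> measurable B ->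
  Pr (A `|` B) = Pr A + Pr B - Pr (A `&` B).
Proof.
move=> mA mB; rewrite (fine_probabilityDI (measurableU _ _ mA mB) mB).
rewrite setDUl setDv setU0 setIUl setIid (setUidr (@subIsetr _ _ _)).
by rewrite [X in _ = X + _ - _](fine_probabilityDI mA mB); lra.
Qed.

Lemma fine_probability_setC A : measurable A -> Pr (~` A) = 1 - Pr A.
Proof.
move=> mA; apply/EFin_inj; rewrite EFinB !fine_probability//.
  exact: probability_setC.
exact: measurableC.
Qed.

Lemma measurable_forall_seq (I : eqType) (c : seq I) (E : I -> set X) :
  (forall p, measurable (E p)) -> measurable [set x | forall p, p \in c -> E p x].
Proof. by move=> mE; exact: (@fin_bigcap_measurable _ _ _ [set` c]).
Qed.

(** A union bound inside [D]: each condition removes at most [e] of its mass. *)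
Lemma fine_probability_forall_seq (I : eqType) (c : seq I) (E : I -> set X) D (e : R) :
  measurable D -> (forall p, measurable (E p)) ->
  (forall p, p \in c -> Pr D <= Pr (D `&` E p) + e) ->
  Pr D <= Pr (D `&` [set x | forall p, p \in c -> E p x]) + (size c)%:R * e.
Proof.
move=> mD mE; elim: c => [|q c IH] cD.
  rewrite mul0r addr0; apply: le_fine_probability => //.
  by apply: measurableI => //; exact: measurable_forall_seq.
have {}IH := IH (fun p pc => cD p (mem_behead (s := q :: c) pc)).
have mc := measurable_forall_seq c mE; set F := [set x | _] in IH mc.
have -> : [set x | forall p, p \in q :: c -> E p x] = F `&` E q.
  apply/seteqP; split=> [x qc|x [Fx Ex] p].
    by split=> [p pc|]; apply: qc; rewrite inE ?eqxx// pc orbT.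
  by rewrite inE => /orP[/eqP ->//|]; exact: Fx.
have mDF := measurableI _ _ mD mc.
rewrite setIA; have := fine_probabilityDI mDF (mE q).
have := fine_probabilityDI mD (mE q); have := cD q (mem_head _ _).
have : Pr (D `&` F `\` E q) <= Pr (D `\` E q).
  by apply: le_fine_probability => [||x [[]]//]; exact: measurableD.
by rewrite /= -natr1; lra.
Qed.

(** A Bonferroni inequality with a crude count of pairs: [D n] meets the union of its predecessors
    in mass at most [n * e], and [n ^ 2 + n <= (n + 1) ^ 2]. *)
Lemma fine_probability_bigcup_ge (D : nat -> set X) (e : R) n :
  0 <= e ->
  (forall i, measurable (D i)) ->
  (forall i j, (i < j < n)%N -> Pr (D i `&` D j) <= e) ->
  \sum_(i < n) Pr (D i) <= Pr (\big[setU/set0]_(i < n) D i) + n%:R ^+ 2 * e.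
Proof.
move=> e0 mD; elim: n => [|n IH] De; first by rewrite !big_ord0 measure0 /=; lra.
have mU (m : nat) : measurable (\big[setU/set0]_(i < m) D i) by exact: bigsetU_measurable.
have DnU m : (m <= n)%N ->
    Pr (D n `&` \big[setU/set0]_(i < m) D i) <= m%:R * e.
  elim: m => [|m IHm] mn; first by rewrite big_ord0 setI0 measure0 /= mul0r.
  rewrite big_ord_recr/= setIUr.
  have mDI A : measurable A -> measurable (D n `&` A) by exact: measurableI.
  rewrite (fine_probabilityU (mDI _ (mU m)) (mDI _ (mD m))).

  have := fine_probability_ge0 (D n `&` \big[setU/set0]_(i < m) D i `&` (D n `&` D m)).
  have := IHm (ltnW mn); have := De m n; rewrite mn ltnSn setIC => /(_ isT).
  by rewrite -natr1; lra.
have {}IH : \sum_(i < n) Pr (D i) <= Pr (\big[setU/set0]_(i < n) D i) + n%:R ^+ 2 * e.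
  by apply: IH => i j /andP[ij jn]; apply: De; rewrite ij ltnS ltnW.
rewrite !big_ord_recr/= setUC (fine_probabilityU (mD n) (mU n)).
have := DnU n (leqnn n); have := mulr_ge0 (ler0n R n) e0.
by rewrite -natr1 sqrrD mulr1 expr1n !mulrDl mul1r; lra.
Qed.

Lemma measurable_seqDU (P : nat -> set X) n :
  (forall i, measurable (P i)) -> measurable (seqDU P n).
Proof. by move=> mP; apply: measurableD => //; exact: bigsetU_measurable. Qed.

Lemma fine_probability_seqDU (P : nat -> set X) n : (forall i, measurable (P i)) ->
  Pr (\big[setU/set0]_(i < n) P i) = \sum_(i < n) Pr (seqDU P i).
Proof.
move=> mP; have mD i := measurable_seqDU i mP; apply/EFin_inj.
rewrite fine_probability; last exact: bigsetU_measurable.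
rewrite bigsetU_seqDU (measure_bigsetU mu mD (@trivIset_seqDU _ P)) -sumEFin.
by apply: eq_bigr => i _; rewrite fine_probability.
Qed.

Lemma fine_probability_cover (P : nat -> set X) (e : R) :
  (forall n, measurable (P n)) -> \bigcup_n P n = setT -> 0 < e ->
  exists n, 1 - e < Pr (\big[setU/set0]_(i < n) P i).
Proof.
move=> mP PT e0; have mD n := measurable_seqDU n mP.
have : (fun n => (\sum_(0 <= i < n) mu (seqDU P i))%E) @ \oo --> mu (\bigcup_n seqDU P n).
  by apply: measure_sigma_additive => //; exact: trivIset_seqDU.
rewrite -seqDU_bigcup_eq PT probability_setT => /fine_cvgP[_] /=.
move=> /cvgr_gt /(_ (1 - e)); rewrite ltrBlDr ltrDl => /(_ e0).
move=> [n _ /(_ n (leqnn n))] /=.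
under eq_bigr do rewrite -fine_probability//.
by rewrite sumEFin big_mkord /= -fine_probability_seqDU// => h; exists n.
Qed.

End probability_lemmas.

(** * Transfer of slices by weak containment *)

Section transfer.
Context (R : realType) (G : groupType).
Context dX (X : measurableType dX) (mu : probability X R) (f : pmp_action G mu).
Context dY (Y : measurableType dY) (nu : probability Y R) (g : pmp_action G nu).
Hypothesis fg : weakly_contains f g.
Local Notation PX A := (fine (mu A)).
Local Notation PY A := (fine (nu A)).

(** Weak containment in a form suited to certificates: sets are indexed by any type through a finite
    list, and images become preimages because the action preserves measure. *)
Lemma weakly_contains_seq (T : eqType) (B : T -> set Y) (r : seq T) (K : seq G) (e : R) :
  (forall t, measurable (B t)) -> 0 < e ->
  exists A : T -> set X, (forall t, measurable (A t)) /\
    forall s t a, s \in r -> t \in r -> a \in K ->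
      `|PX (A s `&` f a @^-1` A t) - PY (B s `&` g a @^-1` B t)| < e.
Proof.
move=> mB e0.
have [|A mA AB] :=
  fg (B := fun i : 'I_(size r) => B (tnth (in_tuple r) i)) _ (finite_seq K) e0.
  by move=> i; exact: mB.
(* Indices outside [r] get the empty set, which keeps every [A' t] measurable. *)
pose A' t := if insub (index t r) is Some i then A i else set0.
exists A'; split=> [t|s t a sr tr aK]; first by rewrite /A'; case: insub.
have rE t' : t' \in r -> exists2 i, A' t' = A i & B t' = B (tnth (in_tuple r) i).
  move=> t'r; have ir : (index t' r < size r)%N by rewrite index_mem.
  exists (Ordinal ir); first by rewrite /A' insubT.
  by rewrite (tnth_nth t') /= nth_index.
have [i -> ->] := rE s sr; have [j -> ->] := rE t tr.
have image_shift (Z : Type) (h k : Z -> Z) (C D : set Z) : cancel h k ->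
    C `&` h @^-1` D = h @^-1` (h @` C `&` D).
  move=> hk; apply/seteqP; split=> [x [Cx Dx]|x [[y Cy yx] Dx]].
    by split=> //; exists x.
  by split=> //; rewrite -(hk x) -yx hk.
rewrite (image_shift _ _ _ _ _ (actKx f a)) (image_shift _ _ _ _ _ (actKx g a)).
have mX : measurable (f a @` A i `&` A j).
  by rewrite act_image; apply: measurableI => //; exact: measurable_act_preimage.
have mY : measurable (g a @` B (tnth (in_tuple r) i) `&` B (tnth (in_tuple r) j)).
  by rewrite act_image; apply: measurableI => //; exact: measurable_act_preimage.
rewrite !act_preserving// -lte_fin -abse_EFin EFinB !fine_probability//.
exact: AB.
Qed.

Lemma weakly_contains_transfer (E : G -> set Y) (c : nat -> seq (G * G)) (F : seq G)
    (N : nat) (e : R) : (forall a, measurable (E a)) -> 0 < e ->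
  exists E' : G -> set X, [/\ (forall a, measurable (E' a)),
    (forall a, a \in F -> PX (E' a) <= PY (E a) + e) &
    PY (\big[setU/set0]_(n < N) [set y | forall p, p \in c n -> E p.2 (g p.1 y)]) <=
    PX (\big[setU/set0]_(n < N) [set x | forall p, p \in c n -> E' p.2 (f p.1 x)]) + e].
Proof.
move=> mE e0; pose P n := [set y | forall p, p \in c n -> E p.2 (g p.1 y)].
have mP n : measurable (P n).
  apply: (@measurable_forall_seq _ _ _ (c n) (fun p => g p.1 @^-1` E p.2)) => p.
  exact: measurable_act_preimage.
(* The cells [seqDU P n] are disjoint and contained in [P n], so that pairwise
   intersections, all that weak containment controls, determine the estimate. *)
pose B (t : G + nat) := match t with inl a => E a | inr n => seqDU P n end.
have mB t : measurable (B t) by case: t => [a|n] //=; exact: measurable_seqDU.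
pose L := (\sum_(n < N) size (c n))%N.
(* The losses in units of [h]: one per cell, two per certificate entry, and [N ^ 2] for overlaps of
   cells. Dividing by [C + 1] below avoids a zero denominator when [N = 0]. *)
pose C : R := N%:R + 2 * L%:R + N%:R ^+ 2.
have C0 : 0 <= C by rewrite !addr_ge0// ?mulr_ge0// exprn_ge0.
pose h := e / (C + 1).
have h0 : 0 < h by rewrite divr_gt0// ltr_wpDl.
have hC : h * (C + 1) = e by rewrite divfK// gt_eqF// ltr_wpDl.
have Ch0 : 0 <= C * h by rewrite mulr_ge0// ltW.
pose w := flatten [seq c n | n <- iota 0 N].
have wP n p : (n < N)%N -> p \in c n -> p \in w.
  move=> nN pc; apply/flattenP; exists (c n) => //.
  by apply/mapP; exists n => //; rewrite mem_iota.
pose r : seq (G + nat) :=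
  [seq inl a | a <- F ++ [seq p.2 | p <- w]] ++ [seq inr n | n <- iota 0 N].
(* The label [1%g] gives control of plain intersections, hence also of single sets. *)
have [A [mA AB]] := weakly_contains_seq r (1%g :: [seq p.1 | p <- w]) mB h0.
have rl a : a \in F ++ [seq p.2 | p <- w] -> inl a \in r.
  by move=> aF; rewrite mem_cat map_f.
have rr n : (n < N)%N -> inr n \in r.
  by move=> nN; rewrite mem_cat orbC map_f// mem_iota.
have A1 s t : s \in r -> t \in r -> `|PX (A s `&` A t) - PY (B s `&` B t)| < h.
  by move=> sr tr; have := AB s t 1%g sr tr (mem_head _ _); rewrite !act1 !preimage_id.
have A2 s : s \in r -> `|PX (A s) - PY (B s)| < h.
  by move=> sr; have := A1 s s sr sr; rewrite !setIid.
exists (fun a => A (inl a)); split=> // [a aF|].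
  have := A2 (inl a); rewrite rl ?mem_cat ?aF// => /(_ isT) /=.
  rewrite ltr_distl => /andP[_]; lra.
pose P' n := [set x | forall p, p \in c n -> A (inl p.2) (f p.1 x)].
have mP' n : measurable (P' n).
  apply: (@measurable_forall_seq _ _ _ (c n) (fun p => f p.1 @^-1` A (inl p.2))) => p.
  exact: measurable_act_preimage.
pose D n := A (inr n) `&` P' n.
have mD n : measurable (D n) by exact: measurableI.
(* In [Y] the cell lies inside each condition of [c n]. In [X] one condition therefore costs at most
   [2 * h]: one [h] for the intersection and one for the cell itself. *)
have D_ge n : (n < N)%N -> PY (seqDU P n) <= PX (D n) + (h + (size (c n))%:R * (2 * h)).
  move=> nN; have An := A2 _ (rr n nN).
  have : PX (A (inr n)) <= PX (D n) + (size (c n))%:R * (2 * h).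
    apply: (fine_probability_forall_seq (E := fun p => f p.1 @^-1` A (inl p.2))) => // p.
      exact: measurable_act_preimage.
    move=> pc; have pw := wP _ _ nN pc.
    have := AB (inr n) (inl p.2) p.1 (rr n nN).
    rewrite rl ?mem_cat ?map_f ?orbT// inE map_f ?orbT// => /(_ isT isT).
    have -> : B (inr n) `&` g p.1 @^-1` B (inl p.2) = B (inr n).
      by apply/setIidPl => y [Py _]; exact: Py.
    by move: An; rewrite !ltr_distl => /andP[_ ?] /andP[? _]; lra.
  by move: An => /=; rewrite ltr_distl => /andP[? _]; lra.
have sum_ge : \sum_(n < N) PX (D n) <= PX (\big[setU/set0]_(n < N) D n) + N%:R ^+ 2 * h.
  apply: fine_probability_bigcup_ge => [||i j /andP[ij jN]]; [exact: ltW|by []|].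
  apply: (@le_trans _ _ (PX (A (inr i) `&` A (inr j)))).
    apply: le_fine_probability; [exact: measurableI|exact: measurableI|].
    by move=> x [[? _] [? _]].
  have := A1 _ _ (rr i (ltn_trans ij jN)) (rr j jN) => /=.
  have -> : seqDU P i `&` seqDU P j = set0.
    apply/eqP/negbNE/negP => /set0P /(@trivIset_seqDU _ P i j I I) ijE.
    by rewrite ijE ltnn in ij.
  by rewrite measure0 /= subr0 => /ltW; apply: le_trans; exact: ler_norm.
have U_le : PX (\big[setU/set0]_(n < N) D n) <= PX (\big[setU/set0]_(n < N) P' n).
  apply: le_fine_probability; [exact: bigsetU_measurable|exact: bigsetU_measurable|].
  by rewrite -!bigcup_mkord; apply: subset_bigcup => n _; exact: subIsetr.
suff : PY (\big[setU/set0]_(n < N) P n) <= PX (\big[setU/set0]_(n < N) P' n) + e by [].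
rewrite fine_probability_seqDU//.
have : \sum_(n < N) PY (seqDU P n) <=
    \sum_(n < N) (PX (D n) + (h + (size (c n))%:R * (2 * h))).
  by apply: ler_sum => i _; exact: D_ge.
rewrite !big_split /= sumr_const card_ord -mulr_suml -natr_sum -mulr_natl -/L.
move: hC; rewrite /C !mulrDr mulr1; lra.
Qed.
End transfer.

(** * A generating set for [f] of nearly the same cost *)

Lemma gcost_le_cost (R : realType) (G : groupType)
    (dX : measure_display) (X : measurableType dX) (mu : probability X R)
    (dY : measure_display) (Y : measurableType dY) (nu : probability Y R)
    (f : pmp_action G mu) (g : pmp_action G nu) (A : set (Y * discrete_group G)) (e : R) :
  finitely_generated G -> weakly_contains f g ->
  measurable A -> generates g A -> 0 < e ->
  (gcost f <= (nu \x counting) A + e%:E)%E.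
Proof.
move=> Gfg fg mA gA e0; have [enum enumP] := finitely_generated_enum Gfg.
have [_ /finite_seqP[s ->] sgen] := Gfg.
pose E (a : G) : set Y := ysection A a.
have mE a : measurable (E a) by exact: measurable_ysection.
have AE p y : A (g p.1 y, p.2) = E p.2 (g p.1 y).
  by rewrite /E ysectionE.
have [c0 _ c0P] := generates_certificate f s point gA.
pose v n := [seq (enum p.1, enum p.2)
              | p <- odflt [::] (unpickle n : option (seq (nat * nat)))].
have vP c : exists n, v n = c.
  have [k kP] := choice enumP.
  exists (pickle [seq (k p.1, k p.2) | p <- c]); rewrite /v pickleK /= -map_comp.
  by apply: map_id_in => -[a b] _ /=; rewrite !kP.
(* Lists that are not certificates are replaced by the fixed certificate [c0], so that every point
   of any [P n] is certified. *)
pose c n := if `[< certificate f [set` s] (v n) >] then v n else c0.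
have cP n : certificate f [set` s] (c n) by rewrite /c; case: asboolP.
pose P n := [set y | forall p, p \in c n -> E p.2 (g p.1 y)].
have mP n : measurable (P n).
  apply: (@measurable_forall_seq _ _ _ (c n) (fun p => g p.1 @^-1` E p.2)) => p.
  exact: measurable_act_preimage.
have PT : \bigcup_n P n = setT.
  apply/seteqP; split=> // y _; have [c' Ac' c'P] := generates_certificate f s y gA.
  have [n vn] := vP c'; exists n => // p; rewrite /c vn asboolT//.
  by move=> /Ac'; rewrite AE.
(* Error budget: [d] for all slices together, and [d + d] for the uncertified points under each
   label of [s]. *)
have [d [d0 dE]] : exists d : R, 0 < d /\ d + (size s)%:R * (d + d) = e.
  exists (e / (1 + 2 * (size s)%:R)).
  have s0 : 0 < 1 + 2 * (size s)%:R :> R by rewrite ltr_wpDr// mulr_ge0.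
  by split; [exact: divr_gt0 | field; rewrite gt_eqF].
have [N Nd] := fine_probability_cover nu mP PT d0.
pose F : seq G := undup (s ++ flatten [seq [seq p.2 | p <- c n] | n <- iota 0 N]).
have cF n p : (n < N)%N -> p \in c n -> p.2 \in F.
  move=> nN pc; rewrite mem_undup mem_cat; apply/orP; right.
  apply/flattenP; exists [seq p.2 | p <- c n]; last exact: map_f.
  by apply/mapP; exists n => //; rewrite mem_iota.
(* The successor makes the denominator positive and yields both [size F * h <= d] and [h <= d]. *)
pose h := d / (size F).+1%:R.
have h0 : 0 < h by exact: divr_gt0.
have Fh : (size F)%:R * h <= d.
  by rewrite mulrCA ler_piMr ?(ltW d0)// ler_pdivrMr// mul1r ler_nat.
have [E' [mE' E'F covE']] := weakly_contains_transfer fg c F N mE h0.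
pose P' n := [set x | forall p, p \in c n -> E' p.2 (f p.1 x)].
have mP' n : measurable (P' n).
  apply: (@measurable_forall_seq _ _ _ (c n) (fun p => f p.1 @^-1` E' p.2)) => p.
  exact: measurable_act_preimage.
pose U := \big[setU/set0]_(n < N) P' n.
have mU : measurable U by exact: bigsetU_measurable.
have hd : h <= d by rewrite ler_pdivrMr// ler_peMr ?(ltW d0)// ler1n.
have badU : fine (mu (~` U)) <= d + d.
  rewrite fine_probability_setC//.
  have : fine (nu (\big[setU/set0]_(n < N) P n)) <= fine (mu U) + h by [].
  lra.
pose bad a := if a \in s then ~` U else set0.
have mbad a : measurable (bad a).
  by rewrite /bad; case: ifP => _ //; exact: measurableC.
pose A' : set (X * discrete_group G) := [set p | p.2 \in F /\ (E' p.2 `|` bad p.2) p.1].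
have mEb a : measurable (E' a `|` bad a) by exact: measurableU.
apply: ereal_inf_le; exists ((mu \x counting)%E A').
  exists A' => //; split; first exact: (measurable_groupoid_seq F mEb).
  apply: (generates_generators sgen) => x a /= sa.
  (* Outside [U] all edges labelled by [s] were added by hand; inside [U] some [c n] with [n < N]
     generates them. *)
  have [Ux|nUx] := pselect (U x); last first.
    apply/generated_symm/symm_sub; split; first by rewrite /= mem_undup mem_cat sa.
    by right; rewrite /= /bad sa.
  move: Ux; rewrite /U -bigcup_mkord => -[n /= nN Ex].
  by apply: (cP n) => // p pc; split; [exact: cF pc | left; exact: Ex].
rewrite (product_counting_seq mu (undup_uniq _) mEb).
apply: le_trans (leeD2r _ (product_counting_ge nu (undup_uniq _ : uniq F) mA)).
rewrite -dE.
under eq_bigr do rewrite -fine_probability//.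
under [X in (_ <= X + _)%E]eq_bigr do rewrite -fine_probability//.
rewrite !sumEFin -EFinD lee_fin.
have EU a : a \in F -> fine (mu (E' a `|` bad a)) <=
    fine (nu (E a)) + h + (if a \in s then d + d else 0).
  move=> aF; rewrite fine_probabilityU//; have := E'F a aF.
  have := fine_probability_ge0 mu (E' a `&` bad a).
  rewrite /bad; case: ifP => _; first lra.
  by rewrite measure0 /=; lra.
rewrite big_seq; apply: (le_trans (ler_sum _ EU)); rewrite -big_seq.
rewrite !big_split /= -addrA lerD2l lerD//.
  by rewrite big_const_seq count_predT iter_addr_0 -mulr_natl.
(* Since [F] has no repetitions, at most [size s] of its labels lie in [s], and only these pay
   [d + d]. *)
rewrite -big_mkcond big_const_seq iter_addr_0 -[leLHS]mulr_natl.
apply: ler_wpM2r; first by rewrite addr_ge0// ltW.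
rewrite ler_nat -size_filter; apply: uniq_leq_size.
  by rewrite filter_uniq// undup_uniq.
by move=> a; rewrite mem_filter => /andP[].
Qed.

Theorem theorem9 (R : realType) (G : groupType)
    (dX : measure_display) (X : measurableType dX) (mu : probability X R)
    (dY : measure_display) (Y : measurableType dY) (nu : probability Y R)
    (f : pmp_action G mu) (g : pmp_action G nu) :
  finitely_generated G ->
  standard_borel R X -> standard_borel R Y ->
  weakly_contains f g ->
  (gcost f <= gcost g)%E.
Proof.
move=> Gfg _ _ fg; apply/ereal_infP => _ [A [mA gA] <-].
by apply/lee_addgt0Pr => e e0; exact: (gcost_le_cost Gfg fg mA gA e0).
Qed.
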